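(* For any $n\ge1$ and any $(t_1,t_2,\cdots,t_n)\in\Bbbk^n$, there is an isomorphism of groups $$\mathrm{Aut}_{dg}(\mathcal{A}(t_1,t_2,\cdots,t_n))\cong\{M\in\mathrm{GL}_n(\Bbbk)\mid (t_1,t_2,\cdots,t_n)=(t_1,t_2,\cdots,t_n)M\}.$$
   Context: $\Bbbk$ is an algebraically closed field of characteristic $0$. A cochain DG algebra is a graded $\Bbbk$-algebra $\mathcal{A}$ with a $\Bbbk$-linear differential $\partial_{\mathcal{A}}$ of degree $1$, $\partial_{\mathcal{A}}^2=0$, satisfying $\partial_{\mathcal{A}}(ab)=(\partial_{\mathcal{A}}a)b+(-1)^{|a|}a(\partial_{\mathcal{A}}b)$ for all homogeneous $a,b$. For $(t_1,\dots,t_n)\in\Bbbk^n$, $\mathcal{A}(t_1,\dots,t_n)$ denotes the cochain DG algebra whose underlying graded algebra is the ordinary commutative polynomial algebra $\Bbbk[x_1,\dots,x_n]$ with $|x_i|=1$ and whose differential is determined, via the Leibniz rule, by $\partial_{\mathcal{A}}(x_i)=\sum_{j=1}^{n}t_jx_ix_j$ for all $i$. $\mathrm{Aut}_{dg}(\mathcal{A})$ is the group of DG algebra automorphisms of $\mathcal{A}$, i.e. bijective chain maps $\mathcal{A}\to\mathcal{A}$ (of degree $0$) respecting multiplication and unit. *)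

(* Defs.v *)
From HB Require Import structures.
From mathcomp Require Import all_boot all_order all_algebra.
From mathcomp Require Import boolp.
From mathcomp Require Import ssrcomplements mpoly.

Set Implicit Arguments.
Unset Strict Implicit.
Unset Printing Implicit Defensive.

Import GRing.Theory.
Local Open Scope ring_scope.

(* Gradings are indexed by [int].  The last two fields say that [A] is the
   direct sum of the homogeneous components [gr i].                           *)
Record is_grading (k : fieldType) (A : algType k) (gr : int -> {pred A})
    : Prop := IsGrading {
  gr_submod : forall i, GRing.submod_closed (gr i);
  gr_one : 1 \in gr 0;
  gr_mul : forall i j a b, a \in gr i -> b \in gr j -> a * b \in gr (i + j);
  gr_span : forall a, exists (s : seq int) (f : int -> A),
    [/\ uniq s, forall i, f i \in gr i & a = \sum_(i <- s) f i];
  gr_indep : forall (s : seq int) (f : int -> A),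
    uniq s -> (forall i, f i \in gr i) -> \sum_(i <- s) f i = 0 ->
    forall i, i \in s -> f i = 0 }.

(* For a negative degree [i], (-1)^i = (-1)^|i|.                              *)
Record is_differential (k : fieldType) (A : algType k) (gr : int -> {pred A})
    (d : A -> A) : Prop := IsDifferential {
  diff_linear : linear d;
  diff_degree : forall i a, a \in gr i -> d a \in gr (i + 1);
  diff_square : forall a, d (d a) = 0;
  diff_leibniz : forall i j a b, a \in gr i -> b \in gr j ->
    d (a * b) = d a * b + (-1) ^+ `|i|%N * (a * d b) }.

Record dgAlgebra (k : fieldType) := DGAlgebra {
  dg_alg :> algType k;
  dg_gr : int -> {pred dg_alg};
  dg_d : dg_alg -> dg_alg;
  dg_grading : is_grading dg_gr;
  dg_differential : is_differential dg_gr dg_d }.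

Arguments dg_gr {k} _ _.
Arguments dg_d {k} _ _.

Record is_dg_automorphism (k : fieldType) (A : dgAlgebra k) (f : A -> A)
    : Prop := IsDGAutomorphism {
  aut_bij : bijective f;
  aut_linear : linear f;
  aut_one : f 1 = 1;
  aut_mul : {morph f : a b / a * b};
  aut_degree : forall i a, a \in dg_gr A i -> f a \in dg_gr A i;
  aut_diff : forall a, f (dg_d A a) = dg_d A (f a) }.

Record dgAut (k : fieldType) (A : dgAlgebra k) := DGAut {
  dgaut_fun :> A -> A;
  _ : `[< is_dg_automorphism dgaut_fun >] }.

HB.instance Definition _ (k : fieldType) (A : dgAlgebra k) :=
  [isSub for @dgaut_fun k A].
HB.instance Definition _ (k : fieldType) (A : dgAlgebra k) :=
  [Choice of dgAut A by <:].

Lemma dgautP (k : fieldType) (A : dgAlgebra k) (f : dgAut A) :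
  is_dg_automorphism f.
Proof. by apply/asboolP; case: f. Qed.

Lemma linear_big (k : fieldType) (A : algType k) (f : A -> A) (I : Type)
    (s : seq I) (F : I -> A) :
  linear f -> f (\sum_(i <- s) F i) = \sum_(i <- s) f (F i).
Proof.
move=> lf; have f0 : f 0 = 0.
  by have := lf (-1) 0 0; rewrite scaler0 addr0 scaleN1r addNr.
by elim/big_rec2: _ => // i x y _ <-; rewrite -{1}[F i]scale1r lf scale1r.
Qed.

Lemma is_dg_automorphism_id (k : fieldType) (A : dgAlgebra k) :
  is_dg_automorphism (@id A).
Proof. by split=> //; exists id. Qed.

Lemma is_dg_automorphism_comp (k : fieldType) (A : dgAlgebra k)
    (f g : A -> A) :
  is_dg_automorphism f -> is_dg_automorphism g -> is_dg_automorphism (f \o g).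
Proof.
move=> [bf lf f1 fM fg fd] [bg lg g1 gM gg gd]; split=> /=.
- exact: bij_comp.
- by move=> c x y /=; rewrite lg lf.
- by rewrite g1.
- by move=> x y /=; rewrite gM fM.
- by move=> i a /gg/fg.
- by move=> a; rewrite gd fd.
Qed.

Lemma is_dg_automorphism_inv (k : fieldType) (A : dgAlgebra k)
    (f g : A -> A) :
  is_dg_automorphism f -> cancel f g -> cancel g f -> is_dg_automorphism g.
Proof.
move=> [bf lf f1 fM fgr fd] fK gK; split.
- by exists f.
- by move=> c x y; apply: (can_inj fK); rewrite lf !gK.
- by apply: (can_inj fK); rewrite gK f1.
- by move=> x y; apply: (can_inj fK); rewrite fM !gK.
- move=> i a ai; have [sub _ _ span indep] := dg_grading A.
  have gr0 j : 0 \in dg_gr A j by case: (sub j).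
  have grD j x y : x \in dg_gr A j -> y \in dg_gr A j -> x - y \in dg_gr A j.
    case: (sub j) => _ sl xj yj.
    by have := sl (-1) y x yj xj; rewrite scaleN1r addrC.
  have f0 : f 0 = 0.
    by have := lf (-1) 0 0; rewrite scaler0 addr0 scaleN1r addNr.
  have [s [F [us Fgr ga]]] := span (g a).
  pose s' := i :: rem i s.
  have us' : uniq s'.
    by rewrite /= rem_uniq // andbT mem_rem_uniq // inE eqxx.
  pose F' j := if (j == i) && (i \notin s) then 0 else F j.
  have F'gr j : F' j \in dg_gr A j by rewrite /F'; case: ifP.
  have ga' : g a = \sum_(j <- s') F' j.
    rewrite big_cons {1}/F' eqxx /=; case: ifPn => [is_|/negPn is_].
      rewrite add0r rem_id // ga; apply: eq_big_seq => j js.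
      by rewrite /F'; case: eqP => // ji; rewrite -ji js in is_.
    rewrite ga (big_rem i) //=; congr (_ + _); apply: eq_bigr => j _.
    by rewrite /F' is_ andbF.
  pose G j := f (F' j) - (if j == i then a else 0).
  have Ggr j : G j \in dg_gr A j.
    by apply: grD; [exact: fgr | case: eqP => [->|_]].
  have G0 : \sum_(j <- s') G j = 0.
    rewrite sumrB -(linear_big _ _ lf) -ga' gK -big_mkcond /=.
    rewrite big_cons eqxx big1_seq ?addr0 ?subrr //.
    by move=> j /andP[/eqP-> ]; rewrite mem_rem_uniq // inE eqxx.
  have := indep _ _ us' Ggr G0; rewrite ga' => F0.
  rewrite big_cons big_seq big1 ?addr0 ?F'gr // => j js.
  have := F0 j; rewrite inE js orbT => /(_ isT); rewrite /G.
  have -> : j == i = false.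
    by apply/negP => /eqP ji; move: js; rewrite ji mem_rem_uniq // inE eqxx.
  by rewrite subr0 -{1}f0 => /(can_inj fK).
- by move=> x; apply: (can_inj fK); rewrite fd !gK.
Qed.

Lemma dgaut_inv_ex (k : fieldType) (A : dgAlgebra k) (f : dgAut A) :
  exists g : dgAut A, cancel f g /\ cancel g f.
Proof.
have fP := dgautP f; have [g fK gK] := aut_bij fP.
have gP : `[< is_dg_automorphism g >].
  by apply/asboolP/(is_dg_automorphism_inv fP).
by exists (DGAut gP).
Qed.

Definition dgaut_one (k : fieldType) (A : dgAlgebra k) : dgAut A :=
  DGAut (asboolT (is_dg_automorphism_id A)).
Definition dgaut_mul (k : fieldType) (A : dgAlgebra k) (f g : dgAut A) :
    dgAut A :=
  DGAut (asboolT (is_dg_automorphism_comp (dgautP f) (dgautP g))).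
Definition dgaut_inv (k : fieldType) (A : dgAlgebra k) (f : dgAut A) :
    dgAut A :=
  projT1 (cid (dgaut_inv_ex f)).

Lemma dgaut_mulA (k : fieldType) (A : dgAlgebra k) :
  associative (@dgaut_mul k A).
Proof. by move=> f g h; apply: val_inj. Qed.
Lemma dgaut_mul1 (k : fieldType) (A : dgAlgebra k) :
  left_id (dgaut_one A) (@dgaut_mul k A).
Proof. by move=> f; apply: val_inj. Qed.
Lemma dgaut_mulr1 (k : fieldType) (A : dgAlgebra k) :
  right_id (dgaut_one A) (@dgaut_mul k A).
Proof. by move=> f; apply: val_inj. Qed.
Lemma dgaut_mulV (k : fieldType) (A : dgAlgebra k) :
  left_inverse (dgaut_one A) (@dgaut_inv k A) (@dgaut_mul k A).
Proof.
move=> f; apply: val_inj; apply: funext => x /=.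
by rewrite /dgaut_inv; case: cid => g [fK gK] /=; rewrite fK.
Qed.
Lemma dgaut_mulrV (k : fieldType) (A : dgAlgebra k) :
  right_inverse (dgaut_one A) (@dgaut_inv k A) (@dgaut_mul k A).
Proof.
move=> f; apply: val_inj; apply: funext => x /=.
by rewrite /dgaut_inv; case: cid => g [fK gK] /=; rewrite gK.
Qed.

HB.instance Definition _ (k : fieldType) (A : dgAlgebra k) :=
  isGroup.Build (dgAut A) (@dgaut_mulA k A) (@dgaut_mul1 k A)
    (@dgaut_mulr1 k A) (@dgaut_mulV k A) (@dgaut_mulrV k A).

(* The library's {'GL_n[R]} is restricted to finite rings.                    *)
Record GL (k : fieldType) (n : nat) := GLMx {
  gl_mx :> 'M[k]_n;
  _ : gl_mx \in unitmx }.

HB.instance Definition _ (k : fieldType) (n : nat) :=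
  [isSub for @gl_mx k n].
HB.instance Definition _ (k : fieldType) (n : nat) :=
  [Choice of GL k n by <:].

Lemma gl_unit (k : fieldType) (n : nat) (M : GL k n) : gl_mx M \in unitmx.
Proof. by case: M. Qed.

Lemma gl_mul_unit (k : fieldType) (n : nat) (M N : GL k n) :
  gl_mx M *m gl_mx N \in unitmx.
Proof. by rewrite unitmx_mul !gl_unit. Qed.
Lemma gl_inv_unit (k : fieldType) (n : nat) (M : GL k n) :
  invmx (gl_mx M) \in unitmx.
Proof. by rewrite unitmx_inv gl_unit. Qed.

Definition gl_one (k : fieldType) (n : nat) : GL k n := GLMx (unitmx1 k n).
Definition gl_mul (k : fieldType) (n : nat) (M N : GL k n) : GL k n :=
  GLMx (gl_mul_unit M N).
Definition gl_inv (k : fieldType) (n : nat) (M : GL k n) : GL k n :=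
  GLMx (gl_inv_unit M).

Lemma gl_mulA (k : fieldType) (n : nat) : associative (@gl_mul k n).
Proof. by move=> M N P; apply: val_inj; rewrite /= mulmxA. Qed.
Lemma gl_mul1 (k : fieldType) (n : nat) :
  left_id (gl_one k n) (@gl_mul k n).
Proof. by move=> M; apply: val_inj; rewrite /= mul1mx. Qed.
Lemma gl_mulr1 (k : fieldType) (n : nat) :
  right_id (gl_one k n) (@gl_mul k n).
Proof. by move=> M; apply: val_inj; rewrite /= mulmx1. Qed.
Lemma gl_mulV (k : fieldType) (n : nat) :
  left_inverse (gl_one k n) (@gl_inv k n) (@gl_mul k n).
Proof. by move=> M; apply: val_inj; rewrite /= mulVmx ?gl_unit. Qed.
Lemma gl_mulrV (k : fieldType) (n : nat) :
  right_inverse (gl_one k n) (@gl_inv k n) (@gl_mul k n).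
Proof. by move=> M; apply: val_inj; rewrite /= mulmxV ?gl_unit. Qed.

HB.instance Definition _ (k : fieldType) (n : nat) :=
  isGroup.Build (GL k n) (@gl_mulA k n) (@gl_mul1 k n)
    (@gl_mulr1 k n) (@gl_mulV k n) (@gl_mulrV k n).

Definition fixes_row (k : fieldType) (n : nat) (t : 'rV[k]_n) :
    {pred GL k n} :=
  [pred M : GL k n | t == t *m gl_mx M].

Lemma fixes_row_group (k : fieldType) (n : nat) (t : 'rV[k]_n) :
  group_closed (fixes_row t).
Proof.
split=> [|M N]; rewrite !inE /=; first by rewrite mulmx1.
move=> /eqP tM /eqP tN; rewrite mulmxA -tM {2}tN.
by rewrite mulmxK ?gl_unit.
Qed.

Record GLFix (k : fieldType) (n : nat) (t : 'rV[k]_n) := GLFixMx {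
  glfix_mx :> GL k n;
  _ : glfix_mx \in fixes_row t }.

HB.instance Definition _ (k : fieldType) (n : nat) (t : 'rV[k]_n) :=
  [isSub for @glfix_mx k n t].
HB.instance Definition _ (k : fieldType) (n : nat) (t : 'rV[k]_n) :=
  [Choice of GLFix t by <:].
HB.instance Definition _ (k : fieldType) (n : nat) (t : 'rV[k]_n) :=
  SubChoice_isSubGroup.Build (GL k n) (fixes_row t) (GLFix t)
    (fixes_row_group t).

Definition poly_gr (k : fieldType) (n : nat) (i : int) :
    {pred {mpoly k[n]}} :=
  match i with
  | Posz e => [pred p : {mpoly k[n]} | p \is e.-homog]
  | Negz _ => [pred p : {mpoly k[n]} | p == 0]
  end.

Definition gen_diff (k : fieldType) (n : nat) (t : 'rV[k]_n) (i : 'I_n) :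
    {mpoly k[n]} :=
  \sum_(j < n) t 0 j *: ('X_i * 'X_j).

(* The graded Leibniz rule, all letters having degree 1, applied to the product
   of the letters of [w].                                                     *)
Fixpoint word_diff (k : fieldType) (n : nat) (t : 'rV[k]_n)
    (w : seq 'I_n) : {mpoly k[n]} :=
  if w is i :: w' then
    gen_diff t i * \prod_(j <- w') 'X_j - 'X_i * word_diff t w'
  else 0.

(* x_0 ... x_0 x_1 ... x_1 ..., with [m i] letters x_i.                       *)
Definition monomial_word (n : nat) (m : 'X_{1..n}) : seq 'I_n :=
  flatten [seq nseq (m i) i | i <- enum 'I_n].

Definition poly_diff (k : fieldType) (n : nat) (t : 'rV[k]_n)
    (p : {mpoly k[n]}) : {mpoly k[n]} :=
  \sum_(m <- msupp p) p@_m *: word_diff t (monomial_word m).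

Definition tform (k : fieldType) (n : nat) (t : 'rV[k]_n) : {mpoly k[n]} :=
  \sum_(j < n) t 0 j *: 'X_j.

Lemma gen_diffE (k : fieldType) (n : nat) (t : 'rV[k]_n) (i : 'I_n) :
  gen_diff t i = 'X_i * tform t.
Proof.
by rewrite mulr_sumr; apply: eq_bigr => j _; rewrite scalerAr.
Qed.

Lemma word_diffE (k : fieldType) (n : nat) (t : 'rV[k]_n) (w : seq 'I_n) :
  word_diff t w = (odd (size w))%:R *: (tform t * \prod_(j <- w) 'X_j).
Proof.
elim: w => [|i w IH] /=; first by rewrite scale0r.
rewrite IH gen_diffE big_cons; case: (odd _); rewrite /= ?scale1r ?scale0r.
  by rewrite -mulrA subrr.
by rewrite mulr0 subr0 -mulrA mulrCA.
Qed.

Lemma monomial_wordE (k : fieldType) (n : nat) (m : 'X_{1..n}) :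
  \prod_(j <- monomial_word m) 'X_j = 'X_[m] :> {mpoly k[n]}.
Proof.
rewrite /monomial_word big_flatten big_map big_enum mpolyXE_id.
apply: eq_bigr => i _.
by elim: (m i) => [|e IH]; rewrite ?big_nil ?expr0 //= big_cons IH exprS.
Qed.

Lemma size_monomial_word (n : nat) (m : 'X_{1..n}) :
  size (monomial_word m) = mdeg m.
Proof.
rewrite size_flatten /shape -map_comp sumnE big_map big_enum mdegE.
by apply: eq_bigr => i _ /=; rewrite size_nseq.
Qed.

Lemma poly_diff_linear (k : fieldType) (n : nat) (t : 'rV[k]_n) :
  linear (@poly_diff k n t).
Proof.
move=> c p q.
pose D := fun m : 'X_{1..n} => word_diff t (monomial_word m).
have E b r : (msize r <= b)%N ->
    poly_diff t r = \sum_(m : 'X_{1..n < b}) r@_m *: D m.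
  move=> rb; pose I : subFinType _ := 'X_{1..n < b}.
  rewrite /poly_diff (big_mksub I) ?msupp_uniq //=; first last.
    by move=> m /msize_mdeg_lt /leq_trans; apply.
  rewrite big_rmcond //= => m /memN_msupp_eq0 ->.
  by rewrite scale0r.
pose b := maxn (msize (c *: p + q)) (maxn (msize p) (msize q)).
rewrite !(E b) ?leq_max ?leqnn ?orbT //.
rewrite scaler_sumr -big_split /=; apply: eq_bigr => m _.
by rewrite mcoeffD mcoeffZ scalerDl scalerA.
Qed.

Lemma poly_diff_monomial (k : fieldType) (n : nat) (t : 'rV[k]_n)
    (m : 'X_{1..n}) :
  poly_diff t 'X_[m] = (odd (mdeg m))%:R *: (tform t * 'X_[m]).
Proof.
rewrite /poly_diff msuppX big_seq1 mcoeffX eqxx scale1r word_diffE.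
by rewrite size_monomial_word monomial_wordE.
Qed.

Lemma poly_diff_homog (k : fieldType) (n : nat) (t : 'rV[k]_n) (e : nat)
    (p : {mpoly k[n]}) :
  p \is e.-homog -> poly_diff t p = (odd e)%:R *: (tform t * p).
Proof.
move=> /dhomogP hp; rewrite {2}(mpolyE p) mulr_sumr scaler_sumr.
rewrite /poly_diff big_seq_cond [RHS]big_seq_cond; apply: eq_bigr => m.
rewrite andbT => /hp em.
rewrite word_diffE size_monomial_word monomial_wordE em.
by rewrite -scalerAr !scalerA mulrC.
Qed.

Lemma tform_homog (k : fieldType) (n : nat) (t : 'rV[k]_n) :
  tform t \is 1%N.-homog.
Proof.
by apply: rpred_sum => j _; apply: rpredZ; rewrite dhomogX /= mdeg1.
Qed.

Lemma poly_gr0 (k : fieldType) (n : nat) (i : int) :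
  (0 : {mpoly k[n]}) \in poly_gr i.
Proof. by case: i => e; rewrite inE ?rpred0. Qed.

Lemma poly_gr_grading (k : fieldType) (n : nat) :
  @is_grading k {mpoly k[n]} (@poly_gr k n).
Proof.
split.
- case=> e; split=> [|c p q]; rewrite !inE ?rpred0 ?eqxx //.
    by move=> hp hq; rewrite rpredD ?rpredZ.
  by move=> /eqP -> /eqP ->; rewrite scaler0 addr0.
- exact: dhomog1.
- case=> e [] e' p q hp hq.
  + exact: dhomogM hp hq.
  + by move/eqP: hq => ->; rewrite mulr0; apply: poly_gr0.
  + by move/eqP: hp => ->; rewrite mul0r; apply: poly_gr0.
  + by move/eqP: hp => ->; rewrite mul0r; apply: poly_gr0.
- move=> p; exists [seq Posz e | e <- iota 0 (msize p)].
  exists (fun i => if i is Posz e then pihomog mdeg e p else 0); split.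
  + by rewrite map_inj_uniq ?iota_uniq // => x y [].
  + by case=> e; rewrite inE ?eqxx ?pihomogP.
  + rewrite big_map /= -[in iota _ _](subn0 (msize p)) big_mkord.
    exact: pihomog_partitionE.
- move=> s f us fgr f0 [] e si; last by move: (fgr (Negz e)) => /eqP.
  have := congr1 (pihomog mdeg e) f0; rewrite linear0 linear_sum.
  rewrite (bigD1_seq (Posz e)) //= pihomog_dE; last exact: (fgr (Posz e)).
  rewrite big1 ?addr0 // => -[] e' ne.
    by rewrite (pihomog_ne0 _ (fgr (Posz e'))) //; apply: contra ne => /eqP->.
  by move: (fgr (Negz e')) => /eqP ->; rewrite linear0.
Qed.

Lemma poly_diff_differential (k : fieldType) (n : nat) (t : 'rV[k]_n) :
  @is_differential k {mpoly k[n]} (@poly_gr k n) (@poly_diff k n t).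
Proof.
have d0 : poly_diff t 0 = 0 by rewrite /poly_diff msupp0 big_nil.
have lin := poly_diff_linear t.
split=> //.
- case=> e p hp; last by move/eqP: hp => ->; rewrite d0; apply: poly_gr0.
  rewrite (poly_diff_homog _ hp) -PoszD addn1 -add1n.
  by apply: rpredZ; apply: dhomogM (tform_homog t) hp.
- elim/mpolyind => [|c m p _ _ IH]; first by rewrite !d0.
  rewrite !lin IH addr0.
  have hm : ('X_[m] : {mpoly k[n]}) \is (mdeg m).-homog by rewrite dhomogX.
  rewrite (poly_diff_homog _ hm).
  have hm1 : (odd (mdeg m))%:R *: (tform t * 'X_[m]) \is (1 + mdeg m)%N.-homog.
    by rewrite rpredZ //; apply: dhomogM (tform_homog t) hm.
  rewrite (poly_diff_homog _ hm1) add1n /=.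
  by case: (odd _); rewrite /= ?scale0r ?mulr0 ?scaler0.
- case=> e [] e' a b; rewrite !inE => ha hb.
  + rewrite (poly_diff_homog _ ha) (poly_diff_homog _ hb).
    rewrite (poly_diff_homog _ (dhomogM ha hb)) /= oddD -signr_odd.
    case: (odd e); case: (odd e'); rewrite /= ?scale0r ?scale1r ?mulr0 ?mul0r;
      rewrite ?expr0 ?expr1 ?mul1r ?mulN1r ?add0r ?addr0 ?oppr0 //.
    * by rewrite -mulrA [a * (_ * _)]mulrCA subrr.
    * by rewrite mulrA.
    * by rewrite [a * (_ * _)]mulrCA.
  + by move/eqP: hb => ->; rewrite !d0 !mulr0 d0 addr0.
  + by move/eqP: ha => ->; rewrite !d0 !mul0r d0 mulr0 addr0.
  + by move/eqP: ha => ->; rewrite !d0 !mul0r d0 mulr0 addr0.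
Qed.

Lemma poly_diff_gen (k : fieldType) (n : nat) (t : 'rV[k]_n) (i : 'I_n) :
  poly_diff t 'X_i = \sum_(j < n) t 0 j *: ('X_i * 'X_j).
Proof.
by rewrite poly_diff_monomial mdeg1 scale1r mulrC -gen_diffE.
Qed.

Lemma poly_diff_unique (k : fieldType) (n : nat) (t : 'rV[k]_n)
    (d : {mpoly k[n]} -> {mpoly k[n]}) :
  @is_differential k {mpoly k[n]} (@poly_gr k n) d ->
  (forall i, d 'X_i = \sum_(j < n) t 0 j *: ('X_i * 'X_j)) ->
  d =1 poly_diff t.
Proof.
move=> [lin _ _ leib] dX.
have homX w : (\prod_(j <- w) 'X_j : {mpoly k[n]}) \is (size w).-homog.
  elim: w => [|i w IH]; first by rewrite big_nil dhomog1.
  by rewrite big_cons /= -add1n; apply: dhomogM IH; rewrite dhomogX /= mdeg1.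
have d1 : d 1 = 0.
  have h1 : (1 : {mpoly k[n]}) \in poly_gr (0 : int) by apply: dhomog1.
  have := leib _ _ _ _ h1 h1; rewrite !mulr1 !mul1r => E.
  by apply: (addrI (d 1)); rewrite addr0 -E.
have dw w : d (\prod_(j <- w) 'X_j) = word_diff t w.
  elim: w => [|i w IH] /=; first by rewrite big_nil.
  have hi : ('X_i : {mpoly k[n]}) \in poly_gr (1 : int).
    by rewrite inE dhomogX /= mdeg1.
  have hw : (\prod_(j <- w) 'X_j : {mpoly k[n]}) \in poly_gr (Posz (size w)).
    by rewrite inE homX.
  by rewrite big_cons (leib _ _ _ _ hi hw) IH dX expr1 mulN1r.
move=> p; rewrite {1}(mpolyE p) (linear_big _ _ lin); apply: eq_bigr => m _.
have d0 : d 0 = 0.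
  by have := lin (-1) 0 0; rewrite scaler0 addr0 scaleN1r addNr.
by rewrite -[_ *: 'X_[m]]addr0 lin d0 addr0 -[in LHS]monomial_wordE dw.
Qed.

Definition polyDG (k : fieldType) (n : nat) (t : 'rV[k]_n) : dgAlgebra k :=
  DGAlgebra (poly_gr_grading k n) (poly_diff_differential t).

(* Main.v *)
(** A degree-preserving algebra endomorphism f of k[x_1, ..., x_n] is a linear
    substitution x_i |-> sum_j M_ij x_j.  With T = sum_j t_j x_j the
    differential is p |-> T p in odd degree and 0 in even degree, so f is a
    chain map iff f(T) = T, since f(x_i) <> 0 and the ring is a domain; and
    f(T) = T says t M = t.  With this row convention f |-> M reverses products,
    so the isomorphism sends f to the matrix of its inverse. *)
Require Import Defs.
From mathcomp Require Import all_boot all_order all_algebra.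
From HB Require Import structures.
From mathcomp Require Import boolp.
From mathcomp Require Import mpoly.
Set Implicit Arguments.
Unset Strict Implicit.
Unset Printing Implicit Defensive.
Import GRing.Theory.
Local Open Scope ring_scope.

Section LinearSubstitution.
Variables (k : fieldType) (n : nat).
Implicit Types (v t : 'rV[k]_n) (M N : 'M[k]_n) (p : {mpoly k[n]}).

Lemma tform_coef v j : (tform v)@_U_(j) = v 0 j.
Proof.
rewrite linear_sum (bigD1 j) //= big1 => [|i ij].
  by rewrite mcoeffZ mcoeffXU eqxx mulr1 addr0.
by rewrite mcoeffZ mcoeffXU (negPf ij) mulr0.
Qed.

Lemma tform_inj : injective (@tform k n).
Proof. by move=> v w vw; apply/rowP => j; rewrite -!tform_coef vw. Qed.

Lemma tform_delta i : tform (delta_mx 0 i) = 'X_i :> {mpoly k[n]}.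
Proof.
rewrite /tform (bigD1 i) //= big1 => [|j ji]; rewrite mxE eqxx.
  by rewrite eqxx scale1r addr0.
by rewrite (negPf ji) scale0r.
Qed.

(** The only monomials of degree 1 are the variables, so the coefficients at [U_(j)] determine
    [p]. *)
Lemma homog1_tform p :
  p \is 1%N.-homog -> p = tform (\row_j p@_U_(j)).
Proof.
move=> hp; apply/mpolyP => m.
have [/mdeg1P[j /eqP->]|m1] := boolP (mdeg m == 1%N).
  by rewrite tform_coef mxE.
by rewrite (dhomog_nemf_coeff hp m1) (dhomog_nemf_coeff (tform_homog _) m1).
Qed.

Definition lsubst M p : {mpoly k[n]} := p \mPo [tuple tform (row i M) | i < n].

Lemma lsubst_linear M : linear (lsubst M).
Proof. by move=> c p q; rewrite /lsubst linearP. Qed.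

Lemma lsubst0 M : lsubst M 0 = 0.
Proof. exact: comp_mpoly0. Qed.

Lemma lsubstZ M c p : lsubst M (c *: p) = c *: lsubst M p.
Proof. exact: comp_mpolyZ. Qed.

Lemma lsubst_one M : lsubst M 1 = 1.
Proof. exact: comp_mpoly1. Qed.

Lemma lsubst_mul M : {morph lsubst M : p q / p * q}.
Proof. by move=> p q; rewrite /lsubst rmorphM. Qed.

Lemma lsubstX M i : lsubst M 'X_i = tform (row i M).
Proof. by rewrite /lsubst comp_mpolyXU -tnth_nth tnth_mktuple. Qed.

Lemma lsubst_tform M v : lsubst M (tform v) = tform (v *m M).
Proof.
rewrite /tform (linear_big _ _ (lsubst_linear M)).
under eq_bigr => i _ do rewrite lsubstZ lsubstX.
under eq_bigr => i _ do rewrite scaler_sumr.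
rewrite exchange_big; apply: eq_bigr => j _.
rewrite mxE scaler_suml; apply: eq_bigr => i _.
by rewrite scalerA mxE.
Qed.

Lemma homog_prod_seq (w : seq 'I_n) (F : 'I_n -> {mpoly k[n]}) :
  (forall i, F i \is 1%N.-homog) -> \prod_(i <- w) F i \is (size w).-homog.
Proof.
move=> hF; elim: w => [|i w IH]; first by rewrite big_nil dhomog1.
by rewrite big_cons /= -add1n; apply: dhomogM.
Qed.

(** A monomial of degree [e] is a word of [e] letters, and each letter is sent to a linear form. *)
Lemma lsubst_homog M e p : p \is e.-homog -> lsubst M p \is e.-homog.
Proof.
move=> /dhomogP hp; rewrite (mpolyE p) (linear_big _ _ (lsubst_linear M)).
rewrite big_seq rpred_sum // => m /hp em.
rewrite lsubstZ dhomogZ //.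
rewrite -monomial_wordE (big_morph _ (lsubst_mul M) (lsubst_one M)).
rewrite -em /= -size_monomial_word homog_prod_seq // => i.
by rewrite lsubstX tform_homog.
Qed.

(** Bare functions are compared because a DG automorphism is a function with propositional
    properties. Linearity reduces the claim to monomials, multiplicativity to letters. *)
Lemma mpoly_alg_ext (f g : {mpoly k[n]} -> {mpoly k[n]}) :
  linear f -> f 1 = 1 -> {morph f : p q / p * q} ->
  linear g -> g 1 = 1 -> {morph g : p q / p * q} ->
  (forall i, f 'X_i = g 'X_i) -> f =1 g.
Proof.
move=> lf f1 fM lg g1 gM fg p; rewrite (mpolyE p) !linear_big //.
have scale (h : {mpoly k[n]} -> {mpoly k[n]}) c q :
    linear h -> h (c *: q) = c *: h q.
  move=> lh; have h0 : h 0 = 0.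
    by have := lh (-1) 0 0; rewrite scaler0 addr0 scaleN1r addNr.
  by rewrite -[c *: q]addr0 lh h0 addr0.
apply: eq_bigr => m _; rewrite (scale f) // (scale g) //; congr (_ *: _).
rewrite -monomial_wordE (big_morph _ fM f1) (big_morph _ gM g1).
exact: eq_bigr.
Qed.

Lemma lsubst1 : lsubst 1%:M =1 id.
Proof.
apply: mpoly_alg_ext => // [|||i].
- exact: lsubst_linear.
- exact: lsubst_one.
- exact: lsubst_mul.
- by rewrite lsubstX row1 tform_delta.
Qed.

(** It suffices to compare generators: [lsubst N] sends the [i]-th one to the form of row [i] of
    [N], and [lsubst M] then multiplies that row by [M] on the right. *)
Lemma lsubst_comp M N p : lsubst M (lsubst N p) = lsubst (N *m M) p.
Proof.
apply: (@mpoly_alg_ext (lsubst M \o lsubst N)) => [c a b||a b||||i] /=.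
- by rewrite !lsubst_linear.
- by rewrite !lsubst_one.
- by rewrite !lsubst_mul.
- exact: lsubst_linear.
- exact: lsubst_one.
- exact: lsubst_mul.
- by rewrite !lsubstX lsubst_tform row_mul.
Qed.

(** On each monomial the differential is zero or multiplication by [tform t], according to the
    parity of the degree. The substitution keeps that parity and fixes [tform t]. *)
Lemma lsubst_diff M t p :
  t *m M = t -> lsubst M (poly_diff t p) = poly_diff t (lsubst M p).
Proof.
move=> tM; rewrite (mpolyE p) (linear_big _ _ (poly_diff_linear t)).
rewrite !(linear_big _ _ (lsubst_linear M)).
rewrite (linear_big _ _ (poly_diff_linear t)).
apply: eq_bigr => m _.
have hc : p@_m *: 'X_[m] \is (mdeg m).-homog by rewrite dhomogZ // dhomogX.
rewrite (poly_diff_homog t hc) (poly_diff_homog t (lsubst_homog M hc)).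
by rewrite lsubstZ lsubst_mul lsubst_tform tM.
Qed.

Definition linear_part (f : {mpoly k[n]} -> {mpoly k[n]}) : 'M[k]_n :=
  \matrix_(i, j) (f 'X_i)@_U_(j).

Lemma linear_part_lsubst M : linear_part (lsubst M) = M.
Proof. by apply/matrixP => i j; rewrite mxE lsubstX tform_coef mxE. Qed.

Lemma is_dg_automorphism_lsubst t M :
  M \in unitmx -> t *m M = t -> @is_dg_automorphism k (polyDG t) (lsubst M).
Proof.
move=> uM tM; split.
- by exists (lsubst (invmx M)) => p;
    rewrite lsubst_comp ?mulmxV ?mulVmx // lsubst1.
- exact: lsubst_linear.
- exact: lsubst_one.
- exact: lsubst_mul.
- case=> e p; rewrite !inE; first exact: lsubst_homog.
  by move/eqP->; rewrite lsubst0.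
- by move=> p; apply: lsubst_diff.
Qed.

End LinearSubstitution.

Section Automorphisms.
Variables (k : fieldType) (n : nat) (t : 'rV[k]_n).
Implicit Types f g : dgAut (polyDG t).

(** Preservation of degree makes each [f 'X_i] a linear form, so its degree-1 coefficients lose
    nothing. *)
Lemma dgaut_lsubst f : f =1 lsubst (linear_part f).
Proof.
have [_ lf f1 fM fgr _] := dgautP f.
apply: mpoly_alg_ext => // [|||i].
- exact: lsubst_linear.
- exact: lsubst_one.
- exact: lsubst_mul.
have hX : ('X_i : {mpoly k[n]}) \in poly_gr (1 : int).
  by rewrite inE dhomogX /= mdeg1.
rewrite lsubstX [LHS](homog1_tform (fgr _ _ hX)).
by congr tform; apply/rowP => j; rewrite !mxE.
Qed.

Lemma linear_part_dgaut_mul f g :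
  linear_part (f * g)%g = linear_part g *m linear_part f.
Proof.
(* Viewing the matrix product as the linear part of its own substitution reduces the claim to
   composition of substitutions. *)
rewrite -[RHS]linear_part_lsubst; apply/matrixP => i j; rewrite !mxE.
by rewrite -lsubst_comp -!dgaut_lsubst.
Qed.

Lemma linear_part_dgaut_one : linear_part (1%g : dgAut (polyDG t)) = 1%:M.
Proof. by apply/matrixP => i j; rewrite !mxE mcoeffXU. Qed.

Lemma linear_part_unit f : linear_part f \in unitmx.
Proof.
have := linear_part_dgaut_mul (f^-1)%g f.
by rewrite mulVg linear_part_dgaut_one => /esym/mulmx1_unit[].
Qed.

Lemma linear_part_fix f : t *m linear_part f = t.
Proof.
have [_ _ _ fM _ fd] := dgautP f.
(* A variable is needed as an element of odd degree; without one, row vectors have no entries to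
   compare. *)
case: (pickP (fun _ : 'I_n => true)) => [i _|n0]; last first.
  by apply/rowP => i; have := n0 i.
have fX0 : f 'X_i != 0.
  rewrite -[X in _ != X](lsubst0 (linear_part f)) -dgaut_lsubst.
  rewrite (inj_eq (bij_inj (aut_bij (dgautP f)))).
  by rewrite -msupp_eq0 msuppX.
have hX : ('X_i : {mpoly k[n]}) \is 1%N.-homog by rewrite dhomogX /= mdeg1.
have hfX : (f 'X_i : {mpoly k[n]}) \is 1%N.-homog.
  exact: (@aut_degree _ _ _ (dgautP f) 1).
(* With [T = tform t], the chain condition at ['X_i] reads [f T * f 'X_i = T * f 'X_i], and [f 'X_i]
   cancels. *)
have := fd 'X_i; rewrite /= (poly_diff_homog t hX) (poly_diff_homog t hfX).
rewrite !scale1r fM => /(mulIf fX0).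
by rewrite dgaut_lsubst lsubst_tform => /tform_inj.
Qed.

End Automorphisms.

Theorem corollary4p3 (k : closedFieldType) (char0 : [pchar k] =i pred0)
    (n : nat) (n_gt0 : (1 <= n)%N) (t : 'rV[k]_n) :
  exists phi : {multiplicative dgAut (polyDG t) -> GLFix t}, bijective phi.
Proof.
have fixP (f : dgAut (polyDG t)) :
    GLMx (linear_part_unit (f^-1)%g) \in fixes_row t.
  by rewrite inE /= linear_part_fix.
pose phi f : GLFix t := GLFixMx (fixP f).
have phiM : {morph phi : f g / (f * g)%g}.
  (* Inversion and [linear_part] each reverse products, so the order is restored. *)
  move=> f g; do 2!apply: val_inj; rewrite /= invgM.
  exact: linear_part_dgaut_mul.
pose hphi := isMultiplicative.Build _ _ phi phiM.
exists (HB.pack_for {multiplicative dgAut (polyDG t) -> GLFix t} phi hphi).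
have substP (M : GLFix t) : is_dg_automorphism (lsubst M : polyDG t -> polyDG t).
  apply: is_dg_automorphism_lsubst; first exact: gl_unit.
  by case: M => M /= /eqP.
pose psi (M : GLFix t) : dgAut (polyDG t) := (DGAut (asboolT (substP M)))^-1%g.
exists psi => [f|M].
  (* Stripping the outer inverse leaves [dgaut_lsubst] for the inverse of [f]. *)
  rewrite -[RHS]invgK; congr (_^-1)%g; apply: val_inj; apply: funext => p /=.
  by rewrite dgaut_lsubst.
do 2!apply: val_inj; rewrite /= invgK.
exact: linear_part_lsubst.
Qed.
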